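(* Let $n\ge2$ and $p\ge1$. Let $\varphi:[0,\infty)\to[0,\infty)$ be a continuous, strictly increasing $\Delta_2$-function for which there is a constant $C_\varphi$ such that $\frac{\varphi(t_1)}{t_1}\le C_\varphi\frac{\varphi(t_2)}{t_2}$ whenever $0<t_1\le t_2$. Suppose that there exists $t_0>0$ such that $\varphi(t)\le t$ for $0<t<t_0$. Let $G\subset\mathbb{R}^n$ be a mushrooms-type domain (as defined in the context, built from $\varphi$). If $H$ is an Orlicz function which satisfies the $\Delta_2$-condition and $$\lim_{t\to0^+}t^n\,H\left(\left(\frac{t^{p-1}}{\varphi(t)^{n-1}}\right)^{1/p}\right)=\infty ,$$ then there exists a sequence of functions $(u_k)$ in $L^1_p(G)$ such that $\|\nabla u_k\|_{L^p(G)}=1$ for every $k$ and $$\int_G H\big(|u_k(x)-(u_k)_G|\big)\,dx\to\infty\quad\text{as } k\to\infty .$$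
   Context: An Orlicz function is a function $H:[0,\infty)\to[0,\infty)$ such that: (1) $H$ is continuous; (2) $H$ is strictly increasing; (3) $H$ is convex; (4) $\lim_{t\to0^+}H(t)/t=0$ and $\lim_{t\to\infty}H(t)/t=\infty$; (5) $H(t)/t<H(s)/s$ for $0<t<s$. A function $F:[0,\infty)\to[0,\infty)$ satisfies the $\Delta_2$-condition (is a $\Delta_2$-function) if there is a constant $C$ with $F(2t)\le C F(t)$ for all $t>0$. Mushrooms-type domain: let $(r_m)_{m\ge1}$ be a decreasing sequence of positive numbers converging to zero with $\varphi(r_m)\le r_m$. Let $Q_0=[0,1]^n$. For $m=1,2,\dots$ let $Q_m$ be a closed cube in $\mathbb{R}^n$ with side length $2r_m$ and $P_m$ a closed rectangle (box) with side length $r_m$ for one side and $2\varphi(r_m)$ for the remaining $n-1$ sides. Attach $Q_m$ and $P_m$ together to create ''mushrooms'' ($P_m$ is the stem, $Q_m$ the cap), which are then attached, as pairwise disjoint sets, to the side of $Q_0$ that lies in the hyperplane $x_2=1$. That is, all sets have sides parallel to the coordinate axes and lie in $\{x_2\ge1\}$ for $m\ge 1$, the side of $P_m$ of length $r_m$ is in the $x_2$-direction, the face of $P_m$ in $\{x_2=1\}$ is contained in the face $\{x_2=1\}$ of $Q_0$, the opposite face of $P_m$, in $\{x_2=1+r_m\}$, is contained in a face of $Q_m$, $Q_m\subset\{x_2\ge1+r_m\}$, and the sets $Q_m\cup P_m$ are pairwise disjoint. Let $Q_m^*$ and $P_m^*$ be the images of $Q_m$ and $P_m$ under reflection across the hyperplane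 $x_2=\frac12$. Then $$G=\operatorname{int}\Big(Q_0\cup\bigcup_{m=1}^\infty\big(Q_m\cup P_m\cup Q_m^*\cup P_m^*\big)\Big).$$ $L^1_p(G)$ is the space of distributions on $G$ whose first order derivatives are in $L^p(G)$; such distributions are (represented by) functions in $L^p_{\mathrm{loc}}(G)$. $u_G=|G|^{-1}\int_G u\,dx$ is the integral average. *)

(* Defs.v *)
From HB Require Import structures.
From mathcomp Require Import all_boot all_order all_algebra.
From mathcomp Require Import all_classical all_reals all_analysis.

Set Implicit Arguments.
Unset Strict Implicit.
Unset Printing Implicit Defensive.

Import Order.TTheory GRing.Theory Num.Theory.
Import numFieldNormedType.Exports.

Local Open Scope classical_set_scope.
Local Open Scope ring_scope.

(* The sigma-algebra on row vectors generated by the coordinates; over a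
   realType this is the Borel sigma-algebra of R^n. *)
Section measurable_rV.
Context {R : realType} (n : nat).

Definition rV_coord (i : 'I_n) (x : 'rV[R]_n) : R := x 0 i.

Let sigma0 : g_sigma_preimage rV_coord set0.
Proof. exact: sigma_algebra0. Qed.

Let sigmaC A : g_sigma_preimage rV_coord A -> g_sigma_preimage rV_coord (~` A).
Proof. exact: sigma_algebraC. Qed.

Let sigmaU (F : _^nat) : (forall i, g_sigma_preimage rV_coord (F i)) ->
  g_sigma_preimage rV_coord (\bigcup_i F i).
Proof. exact: sigma_algebra_bigcup. Qed.

HB.instance Definition _ := @isMeasurable.Build
  (measure_tuple_display default_measure_display)
  'rV[R]_n (g_sigma_preimage rV_coord) sigma0 sigmaC sigmaU.

End measurable_rV.

Section lebesgue_rV.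
Context {R : realType}.

Definition rV_cons n (x : measurableTypeR R * 'rV[R]_n) : 'rV[R]_n.+1 :=
  \row_i (if unlift 0 i is Some j then x.2 0 j else x.1).

Definition rV_uncons n (v : 'rV[R]_n.+1) : measurableTypeR R * 'rV[R]_n :=
  (v 0 0, \row_j v 0 (lift 0 j)).

Lemma rV_consK n : cancel (@rV_cons n) (@rV_uncons n).
Proof.
move=> [x v]; rewrite /rV_uncons /rV_cons mxE unlift_none/=; congr pair.
by apply/rowP => j; rewrite !mxE liftK.
Qed.

Lemma rV_unconsK n : cancel (@rV_uncons n) (@rV_cons n).
Proof.
move=> v; apply/rowP => i; rewrite mxE.
by case: unliftP => [j|] -> //=; rewrite mxE.
Qed.

Lemma measurable_rV_coord n (i : 'I_n) :
  measurable_fun [set: 'rV[R]_n] (@rV_coord R n i).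
Proof.
move=> _ Y mY; rewrite setTI; apply: sub_sigma_algebra => /=.
rewrite -bigcup_seq/=; exists i => /=; first by rewrite mem_index_enum.
by exists Y => //; rewrite setTI.
Qed.

Lemma measurable_fun_rV d (T : measurableType d) n (f : T -> 'rV[R]_n) :
  (forall i, measurable_fun [set: T] (fun x => f x 0 i)) ->
  measurable_fun [set: T] f.
Proof.
move=> mf; apply: (@measurability _ _ _ _ _ _
  (\big[setU/set0]_(i < n) preimage_set_system setT (@rV_coord R n i) measurable)) => //.
move=> _ [A + <-]; rewrite -bigcup_seq => -[i _ [B mB <-]].
rewrite !setTI -comp_preimage -[X in measurable X]setTI; exact: (mf i).
Qed.

Lemma measurable_rV_cons n : measurable_fun [set: _] (@rV_cons n).
Proof.
apply: measurable_fun_rV => i.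
case: (unliftP 0 i) => [j ->|->].
  rewrite (_ : (fun _ => _) = @rV_coord R n j \o snd); last first.
    by apply/funext => x /=; rewrite mxE liftK.
  by apply: measurableT_comp => //; exact: measurable_rV_coord.
rewrite (_ : (fun _ => _) = fst) //.
by apply/funext => x /=; rewrite mxE unlift_none.
Qed.

Lemma measurable_rV_uncons n : measurable_fun [set: _] (@rV_uncons n).
Proof.
apply/measurable_fun_pairP; split; first exact: (@measurable_rV_coord n.+1 0).
apply: measurable_fun_rV => i.
rewrite (_ : (fun _ => _) = @rV_coord R n.+1 (lift 0 i)).
  exact: measurable_rV_coord.
by apply/funext => x /=; rewrite mxE.
Qed.


HB.instance Definition _ n := isMeasurableFun.Build _ _ _ _ (@rV_cons n)
  (@measurable_rV_cons n).

Section rV_succ_measure.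
Variables (n : nat) (mu : {sigma_finite_measure set 'rV[R]_n -> \bar R}).

Definition rV_succ_measure : set 'rV[R]_n.+1 -> \bar R :=
  pushforward (@lebesgue_measure R \x mu)%E (@rV_cons n).

Let succ0 : rV_succ_measure set0 = 0%E.
Proof. exact: measure0. Qed.

Let succ_ge0 A : (0 <= rV_succ_measure A)%E.
Proof. exact: measure_ge0. Qed.

Let succ_sigma_additive : semi_sigma_additive rV_succ_measure.
Proof. exact: measure_semi_sigma_additive. Qed.

HB.instance Definition _ := isMeasure.Build _ _ _ rV_succ_measure
  succ0 succ_ge0 succ_sigma_additive.

Let succ_sigma_finite : sigma_finite [set: 'rV[R]_n.+1] rV_succ_measure.
Proof.
have /sigma_finiteP[F [FT ndF Foo]] := sigma_finiteT (@lebesgue_measure R).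
have /sigma_finiteP[A [AT ndA Aoo]] := sigma_finiteT mu.
exists (fun k => @rV_uncons n @^-1` (F k `*` A k)) => [|k].
  rewrite -preimage_bigcup -[LHS](@preimage_setT _ _ (@rV_uncons n)).
  congr (_ @^-1` _); apply/seteqP; split=> // -[x y] _.
  have [i _ Fx] : (\bigcup_i F i) x by rewrite -FT.
  have [j _ Ay] : (\bigcup_i A i) y by rewrite -AT.
  exists (maxn i j) => //; split => /=.
    by move: x Fx; exact/subsetPset/ndF/leq_maxl.
  by move: y Ay; exact/subsetPset/ndA/leq_maxr.
have [mF Fk] := Foo k; have [mA Ak] := Aoo k.
split.
  rewrite -[X in measurable X]setTI; apply: measurable_rV_uncons => //.
  exact: measurableX.
rewrite /rV_succ_measure /pushforward -comp_preimage.
rewrite (_ : _ \o _ = id); last by apply/funext => x; exact: rV_consK.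
by rewrite preimage_id product_measure1E// lte_mul_pinfty// ge0_fin_numE.
Qed.

HB.instance Definition _ := Measure_isSigmaFinite.Build _ _ _ rV_succ_measure
  succ_sigma_finite.

End rV_succ_measure.

(* Lebesgue measure on the Borel sets of R^n, as the n-fold product of the
   one-dimensional Lebesgue measure *)
Fixpoint lebesgue_rV (n : nat) : {sigma_finite_measure set 'rV[R]_n -> \bar R} :=
  if n is m.+1 then rV_succ_measure (lebesgue_rV m) else \d_(0 : 'rV[R]_0).

End lebesgue_rV.

Section sobolev.
Context {R : realType} {n : nat}.
Implicit Types (G : set 'rV[R]_n) (u : 'rV[R]_n -> R) (p : R).

Definition partial (i : 'I_n) u : 'rV[R]_n -> R := 'D_(delta_mx 0 i) u.

Definition smooth u := forall s : seq 'I_n,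
  continuous (foldr partial u s) /\
  forall (i : 'I_n) x, derivable (foldr partial u s) x (delta_mx 0 i).

Definition test_function G u :=
  smooth u /\ exists K, [/\ compact K, K `<=` G & forall x, ~ K x -> u x = 0].

(* f \_ G is f extended by 0 outside of G *)
Definition Lp_space G p : set ('rV[R]_n -> R) :=
  [set u | u \_ G \in Lfun (lebesgue_rV n) p%:E].

Definition Lp_loc G p : set ('rV[R]_n -> R) :=
  [set u | forall K, compact K -> K `<=` G -> Lp_space K p u].

(* Local integrability of u and g makes both sides of the integration by parts
   formula integrals of integrable functions. *)
Definition weak_partial G (i : 'I_n) u (g : 'rV[R]_n -> R) :=
  [/\ Lp_loc G 1 u, Lp_loc G 1 g &
    forall psi, test_function G psi ->
      \int[lebesgue_rV n]_(x in G) (u x * partial i psi x) =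
      - \int[lebesgue_rV n]_(x in G) (g x * psi x)].

Definition weak_gradient G u (g : 'rV[R]_n -> 'rV[R]_n) :=
  forall i, weak_partial G i u (fun x => g x 0 i).

(* Distributions whose first order derivatives are in L^p(G) are functions in
   L^p_loc(G), so they are represented by such functions. *)
Definition L1p G p : set ('rV[R]_n -> R) :=
  [set u | Lp_loc G p u /\
    exists2 g, weak_gradient G u g & forall i, Lp_space G p (fun x => g x 0 i)].

(* `|v| on 'rV[R]_n is the sup norm, so the Euclidean norm is spelled out *)
Definition eucl_norm (v : 'rV[R]_n) : R := Num.sqrt (\sum_i v 0 i ^+ 2).

Definition Lp_norm G p (g : 'rV[R]_n -> 'rV[R]_n) : \bar R :=
  'N[lebesgue_rV n]_p%:E[EFin \o (eucl_norm \o g) \_ G].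

Definition average G u : R :=
  (fine (lebesgue_rV n G))^-1 * \int[lebesgue_rV n]_(x in G) u x.

End sobolev.

Section functions_on_the_half_line.
Context {R : realType}.
Implicit Types F H : R -> R.

(* functions [0, +oo[ -> [0, +oo[ are functions on R whose values at negative
   arguments are irrelevant *)
Definition nonneg_on_half_line F := forall t, 0 <= t -> 0 <= F t.

Definition continuous_on_half_line F :=
  {within (`[0, +oo[ : set R), continuous F}.

Definition strictly_increasing_on_half_line F :=
  forall s t, 0 <= s -> s < t -> F s < F t.

Definition Delta2 F := exists C, forall t, 0 < t -> F (2 * t) <= C * F t.

Record Orlicz H : Prop := {
  Orlicz_ge0 : nonneg_on_half_line H;
  Orlicz_continuous : continuous_on_half_line H;
  Orlicz_increasing : strictly_increasing_on_half_line H;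
  Orlicz_convex : convex_function (`[0, +oo[%classic : set R) H;
  Orlicz_cvg0 : H t / t @[t --> 0^'+] --> 0;
  Orlicz_cvgy : H t / t @[t --> +oo] --> +oo;
  Orlicz_ratio : forall t s : R, 0 < t -> t < s -> H t / t < H s / s }.

End functions_on_the_half_line.

Section mushrooms.
Context {R : realType} {n : nat}.

(* the closed box with lowest corner a and side lengths l *)
Definition box (a l : 'rV[R]_n) : set 'rV[R]_n :=
  [set x | forall i, a 0 i <= x 0 i <= a 0 i + l 0 i].

Definition box_face (a l : 'rV[R]_n) (F : set 'rV[R]_n) := exists i,
  F = box a l `&` [set x | x 0 i = a 0 i] \/
  F = box a l `&` [set x | x 0 i = a 0 i + l 0 i].

Definition unit_cube : set 'rV[R]_n := box 0 (const_mx 1).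

(* the index of the coordinate x_2; indices start at 0 *)
Definition snd_coord (hn : (2 <= n)%N) : 'I_n := Ordinal hn.

Variables (hn : (2 <= n)%N) (phi : R -> R).
Let x2 := snd_coord hn.

Definition cap_sides (r : R) : 'rV[R]_n := const_mx (2 * r).

Definition stem_sides (r : R) : 'rV[R]_n :=
  \row_i (if i == x2 then r else 2 * phi r).

(* sequences start at index 0, so r m, cap r a m and stem r b m stand for
   r_(m+1), Q_(m+1) and P_(m+1); a m and b m are the lowest corners of the
   cap and of the stem *)
Definition cap (r : nat -> R) (a : nat -> 'rV[R]_n) m :=
  box (a m) (cap_sides (r m)).
Definition stem (r : nat -> R) (b : nat -> 'rV[R]_n) m :=
  box (b m) (stem_sides (r m)).

Record mushrooms (r : nat -> R) (a b : nat -> 'rV[R]_n) : Prop := {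
  mushrooms_gt0 : forall m, 0 < r m;
  mushrooms_decreasing : forall m k, (m <= k)%N -> r k <= r m;
  mushrooms_cvg : r @ \oo --> 0;
  mushrooms_phi : forall m, phi (r m) <= r m;
  mushrooms_stem_bottom : forall m, b m 0 x2 = 1;
  mushrooms_stem_attached : forall m,
    stem r b m `&` [set x | x 0 x2 = 1] `<=` unit_cube `&` [set x | x 0 x2 = 1];
  mushrooms_cap_above : forall m, cap r a m `<=` [set x | 1 + r m <= x 0 x2];
  mushrooms_cap_attached : forall m, exists2 F,
    box_face (a m) (cap_sides (r m)) F &
    stem r b m `&` [set x | x 0 x2 = 1 + r m] `<=` F;
  mushrooms_disjoint : trivIset setT (fun m => cap r a m `|` stem r b m) }.

(* the reflection across the hyperplane x_2 = 1/2 *)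
Definition reflect (x : 'rV[R]_n) : 'rV[R]_n :=
  \row_i (if i == x2 then 1 - x 0 i else x 0 i).

Definition mushrooms_domain (G : set 'rV[R]_n) := exists r a b,
  mushrooms r a b /\
  G = (unit_cube `|` \bigcup_m (cap r a m `|` stem r b m `|`
        (reflect @` cap r a m) `|` (reflect @` stem r b m)))°.

End mushrooms.

(* Main.v *)
Require Import Defs.
From HB Require Import structures.
From mathcomp Require Import all_boot all_order all_algebra.
From mathcomp Require Import all_classical all_reals all_analysis.
From mathcomp Require Import measurable_realfun ring lra.

Set Implicit Arguments.
Unset Strict Implicit.
Unset Printing Implicit Defensive.

Import Order.TTheory GRing.Theory Num.Theory.
Import numFieldNormedType.Exports.

Local Open Scope classical_set_scope.
Local Open Scope ring_scope.

(** A function that climbs a single stem and is constant on the cap above it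
already has a large oscillation compared with its gradient.  Fix the mushroom
M_m = Q_m + P_m with radius r = r_m, and let u be 0 outside of M_m, equal to
c/2 on the cap, and equal to c s((x_2 - 1)/r) on the stem, where s is a C^1
step from 0 to 1/2 with 0 <= s' <= 1 and s' = 0 off [0, 1].  The gradient of u
lives on the stem and is at most c/r there, so that

  ||grad u||_p <= c r^-1 |P_m|^(1/p) = c (2^(n-1) phi(r)^(n-1) / r^(p-1))^(1/p).

Normalizing the gradient to norm 1 gives c >= T(r) / 2^(n-1), where
T(t) = (t^(p-1) / phi(t)^(n-1))^(1/p).  The average of u is at most a constant
times c |M_m|, which is below c/4 for large m because |M_m| -> 0.  Hence
|u - u_G| >= c/4 on the cap, and the integral of H(|u - u_G|) is at least
r^n H(c/4), which by the Delta_2-condition is at least a constant times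
r^n H(T(r)) and tends to infinity by hypothesis.

What takes work is the weak gradient.  Up to the factor 1_M the function u is a
C^1 function w of x_2 alone.  Near a point of G above {x_2 = 1}, the factor 1_M
is constant, since only finitely many mushrooms reach a given height above the
hyperplane and they are pairwise disjoint and closed
([mushroom_locally_constant]).  At height x_2 <= 1 both w and its derivatives
vanish, because s is C^1 and not merely Lipschitz; so 1_M w is differentiable
there with derivative 0, although 1_M may jump.  This dichotomy is the hypothesis
of [weak_partial_patch], which integrates by parts: for a test function psi, the
product 1_M w psi extended by 0 is C^1 on the whole space along each axis, and
the integral of such a partial derivative is 0 by Fubini's theorem and the
fundamental theorem of calculus ([integral_partial_compact_support]). *)

(** * Borel sets of the space of row vectors *)

Section borel_sets.
Context {R : realType} {n : nat}.
Implicit Types (A K : set 'rV[R]_n) (f : 'rV[R]_n -> R).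

Lemma coord_le_norm (x : 'rV[R]_n) i : `|x 0 i| <= `|x|.
Proof.
by rewrite [leRHS]mx_normrE; apply: (le_bigmax _ (fun ij => `|x ij.1 ij.2|) (0, i)).
Qed.

Lemma coord_preimage_measurable (i : 'I_n) (B : set R) :
  measurable B -> measurable [set x : 'rV[R]_n | B (x 0 i)].
Proof. by move=> mB; rewrite -[X in measurable X]setTI; exact: measurable_rV_coord. Qed.

Lemma forall_coord_measurable (B : 'I_n -> set R) :
  (forall i, measurable (B i)) -> measurable [set x : 'rV[R]_n | forall i, B i (x 0 i)].
Proof.
move=> mB; rewrite (_ : [set x : 'rV[R]_n | forall i, B i (x 0 i)] =
  \bigcap_(i in [set: 'I_n]) [set x : 'rV[R]_n | B i (x 0 i)]).
  by apply: fin_bigcap_measurable => // i _; exact: coord_preimage_measurable.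
by apply/seteqP; split=> [x xB i _|x xB i]; exact: xB.
Qed.

Lemma box_measurable (a l : 'rV[R]_n) : measurable (box a l).
Proof.
apply: (@forall_coord_measurable (fun i => `[a 0 i, a 0 i + l 0 i]%classic)) => i.
exact: measurable_itv.
Qed.

Lemma box_closed (a l : 'rV[R]_n) : closed (box a l).
Proof.
rewrite (_ : box a l = \bigcap_i [set x : 'rV[R]_n | x 0 i \in `[a 0 i, a 0 i + l 0 i]]).
  apply: closed_bigI => i _; apply: (@preimage_closed _ _ (fun x : 'rV[R]_n => x 0 i)
    `[a 0 i, a 0 i + l 0 i]%classic).
    by move=> x _; exact: coord_continuous.
  exact: interval_closed.
apply/seteqP; split=> [x xB i _|x xB i] /=; first by rewrite in_itv; exact: xB.
by have /= := xB i I; rewrite in_itv.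
Qed.

(** The cubes with rational centre and half-side 1/(k+1) form a countable base
of the topology, and each of them is a product of intervals. *)
Lemma open_measurable_rV A : open A -> measurable A.
Proof.
move=> oA.
pose cube (q : 'rV[rat]_n) k :=
  [set x : 'rV[R]_n | forall i, ball (ratr (q 0 i) : R) k.+1%:R^-1 (x 0 i)].
pose D (z : 'rV[rat]_n * nat) := if pselect (cube z.1 z.2 `<=` A) then cube z.1 z.2 else set0.
rewrite (_ : A = \bigcup_z D z).
  apply: countable_bigcupT_measurable => [|z]; first exact: countableP.
  rewrite /D; case: pselect => //= _.
  apply: (@forall_coord_measurable (fun i => ball (ratr (z.1 0 i) : R) z.2.+1%:R^-1)) => i.
  by rewrite ball_itv; exact: measurable_itv.
apply/seteqP; split=> [x Ax|x [z _]]; last by rewrite /D; case: pselect => //= h /h.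
have /nbhs_ballP[e /= e0 eA] : nbhs x A by exact: open_nbhs_nbhs.
have [k kE] : exists k, k.+1%:R^-1 < e / 2 :> R.
  have e20 : 0 < e / 2 by rewrite divr_gt0.
  near \oo => k; exists k; near: k.
  exact: (near_infty_natSinv_lt (PosNum e20)).
have : 0 < k.+1%:R^-1 :> R by rewrite invr_gt0.
have := fun q => erefl (cube q k); rewrite {2}/cube.
move: (k.+1%:R^-1) kE => d dE cubeE d0.
have /choice[q qP] : forall i, exists q : rat, ball (ratr q : R) d (x 0 i).
  move=> i; have /rat_in_itvoo[q] : x 0 i - d < x 0 i + d by lra.
  rewrite in_itv /= => /andP[q1 q2]; exists q.
  by rewrite ball_itv /= in_itv /=; apply/andP; split; lra.
exists (\row_i q i, k) => //; rewrite /D /= cubeE; case: pselect => /= [_|[]].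
  by move=> i; rewrite mxE.
move=> y yq; apply: eA; split=> // u i; rewrite ord1.
have := yq i; have := qP i; rewrite /= mxE !ball_itv /= !in_itv /=.
by move=> /andP[? ?] /andP[? ?]; apply/andP; split; lra.
Unshelve. all: by end_near. Qed.

Lemma closed_measurable_rV A : closed A -> measurable A.
Proof.
move=> cA; rewrite -(setCK A); apply: measurableC; apply: open_measurable_rV.
exact: closed_openC.
Qed.

Lemma compact_closed_rV K : compact K -> closed K.
Proof. by apply: compact_closed; exact: norm_hausdorff. Qed.

Lemma compact_measurable_rV K : compact K -> measurable K.
Proof. by move/compact_closed_rV/closed_measurable_rV. Qed.

Lemma continuous_measurable_rV f : continuous f -> measurable_fun setT f.
Proof.
move=> cf; apply: (measurability _ (RGenOpens.measurableE R)).
move=> _ [_ [a [b ->] <-]]; rewrite setTI; apply: open_measurable_rV.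
by move/continuousP: cf; apply; exact: interval_open.
Qed.
 
Lemma compact_sub_box K : compact K ->
  exists2 B : R, 0 < B & forall x, K x -> forall i, `|x 0 i| <= B.
Proof.
move=> /compact_bounded[M [_ KM]]; exists (`|M| + 1); first by rewrite ltr_wpDl.
move=> x Kx i; apply: le_trans (coord_le_norm _ _) _.
by apply: KM => //; rewrite (le_lt_trans (ler_norm _)) // ltrDl.
Qed.

End borel_sets.

(** * Lebesgue measure of boxes and of compact sets *)

Section lebesgue_measure_of_a_box.
Context {R : realType}.

Let lebesgue_measure_itv_ge0 (a l : R) : 0 <= l ->
  (@lebesgue_measure R) `[a, a + l]%classic = l%:E.
Proof.
rewrite lebesgue_measure_itv /= lte_fin ltrDl le_eqVlt => /orP[/eqP<-|l0].
  by rewrite ltxx.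
by rewrite l0 -EFinB addrAC subrr add0r.
Qed.

Lemma lebesgue_rV_box n (a l : 'rV[R]_n) : (forall i, 0 <= l 0 i) ->
  lebesgue_rV n (box a l) = (\prod_i l 0 i)%:E.
Proof.
elim: n a l => [|n IH] a l l0.
  rewrite big_ord0 /= diracE mem_set // => -[] //.
have -> : lebesgue_rV n.+1 (box a l) =
  (@lebesgue_measure R \x lebesgue_rV n)%E (`[a 0 0, a 0 0 + l 0 0]%classic `*`
     box (\row_i a 0 (lift 0 i)) (\row_i l 0 (lift 0 i))).
  rewrite /= /rV_succ_measure /pushforward; congr (product_measure1 _ _ _).
  apply/seteqP; split=> -[t x] /=.
    move=> tx; split; first by have := tx 0; rewrite /rV_cons mxE unlift_none /= in_itv.
    by move=> i; have := tx (lift 0 i); rewrite /rV_cons !mxE liftK.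
  rewrite in_itv /= => -[t0 x0] i; rewrite /rV_cons mxE.
  by case: unliftP => [j|] -> //=; have := x0 j; rewrite !mxE.
rewrite product_measure1E //; last exact: box_measurable.
rewrite IH => [|i]; last by rewrite mxE.
rewrite big_ord_recl EFinM; congr (_ * _)%E; last first.
  by congr EFin; apply: eq_bigr => i _; rewrite mxE.
exact: lebesgue_measure_itv_ge0.
Qed.

Lemma compact_finite_rV n (K : set 'rV[R]_n) : compact K ->
  (lebesgue_rV n K < +oo)%E.
Proof.
move=> cK; have [B B0 KB] := compact_sub_box cK.
apply: (@le_lt_trans _ _ (lebesgue_rV n (box (const_mx (- B)) (const_mx (2 * B))))).
  apply: le_measure; rewrite ?inE; [exact: compact_measurable_rV|exact: box_measurable|].
  by move=> x /KB xB i; have := xB i; rewrite !mxE ler_norml; lra.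
by rewrite lebesgue_rV_box ?ltry // => i; rewrite mxE; lra.
Qed.

End lebesgue_measure_of_a_box.

(** * Functions with compact support *)

Section compact_support.
Context {R : realType} {n : nat}.
Implicit Types (f g : 'rV[R]_n -> R) (K : set 'rV[R]_n).

(** The complement of a compact set is open, so that [f] vanishes in a
neighbourhood of each of its points. *)
Lemma zero_off_compact_is_derive K f g (v : 'rV[R]_n) : compact K ->
  (forall x, ~ K x -> f x = 0) -> (forall x, is_derive x v f (g x)) ->
  forall x, ~ K x -> g x = 0.
Proof.
move=> cK f0 df x nKx.
have oK : open (~` K) by apply: closed_openC; exact: compact_closed_rV.
have d0 : is_derive x v f 0.
  apply: (@near_eq_is_derive _ _ _ (cst 0)) => //.
  have : nbhs x (~` K) by exact: open_nbhs_nbhs.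
  by apply: filterS => y /f0 ->.
by rewrite -(@derive_val _ _ _ _ _ _ _ (df x)) (@derive_val _ _ _ _ _ _ _ d0).
Qed.

Lemma bounded_integrable_rV A f (M : R) : measurable A ->
  (lebesgue_rV n A < +oo)%E -> measurable_fun A f ->
  (forall x, A x -> `|f x| <= M) -> (lebesgue_rV n).-integrable A (EFin \o f).
Proof.
move=> mA fA mf fM; apply: measurable_bounded_integrable => //.
by exists M; split => [|N MN x Ax]; [exact: num_real|exact/(le_trans (fM x Ax))/ltW].
Qed.

Lemma continuous_bounded_on_compact K f : compact K -> continuous f ->
  exists M, forall x, K x -> `|f x| <= M.
Proof.
move=> cK cf; have /compact_bounded[M [_ KM]] : compact (f @` K).
  by apply: continuous_compact => //; exact: continuous_subspaceT.
exists (`|M| + 1) => x Kx; apply: KM; last by exists x.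
by rewrite (le_lt_trans (ler_norm _)) // ltrDl.
Qed.

Lemma continuous_compact_support_integrable K g : compact K -> continuous g ->
  (forall x, ~ K x -> g x = 0) -> (lebesgue_rV n).-integrable setT (EFin \o g).
Proof.
move=> cK cg g0.
have [M KM] := continuous_bounded_on_compact cK cg.
have mK := compact_measurable_rV cK.
have := bounded_integrable_rV mK (compact_finite_rV cK)
  (measurable_funTS (continuous_measurable_rV cg)) KM.
rewrite integrable_mkcond // restrict_EFin (_ : g \_ K = g) //.
apply/funext => x; rewrite patchE; case: ifPn => // /negP xK.
by rewrite g0 // => Kx; apply: xK; rewrite inE.
Qed.

End compact_support.

(** * Slices of a function along the first coordinate *)

Section slices.
Context {R : realType} {n : nat}.
Implicit Types (f g : 'rV[R]_n.+1 -> R).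

Lemma rV_cons_near (t : R) (x : 'rV[R]_n) (e : R) s y :
  ball t e s -> ball x e y -> ball (rV_cons (t, x)) e (rV_cons (s, y)).
Proof.
move=> ts [e0 xy]; split => // i j; rewrite ord1 !mxE.
by case: unliftP => [k _|_] //=; exact: xy.
Qed.

Lemma rV_cons_continuous_tail (t : R) : continuous (fun x : 'rV[R]_n => rV_cons (t, x)).
Proof.
move=> x A /nbhs_ballP[e /= e0 eA]; apply/nbhs_ballP; exists e => //= y xy.
by apply: eA; apply: rV_cons_near => //; exact: ballxx.
Qed.

Lemma rV_cons_continuous_head (x : 'rV[R]_n) : continuous (fun t : R => rV_cons (t, x)).
Proof.
move=> t A /nbhs_ballP[e /= e0 eA]; apply/nbhs_ballP; exists e => //= s ts.
by apply: eA; apply: rV_cons_near => //; exact: ballxx.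
Qed.

(** Both sides are limits of the same difference quotients, since moving [x]
along the axis [j] moves [rV_cons (t, x)] along the axis [lift 0 j]. *)
Lemma is_derive_tail f (t : R) (x : 'rV[R]_n) j df :
  is_derive (rV_cons (t, x)) (delta_mx 0 (lift 0 j)) f df ->
  is_derive x (delta_mx 0 j) (fun y => f (rV_cons (t, y))) df.
Proof.
have E : (fun h : R => h^-1 *: ((f \o shift (rV_cons (t, x)))
    (h *: delta_mx 0 (lift 0 j)) - f (rV_cons (t, x)))) =
  (fun h : R => h^-1 *: (((fun y => f (rV_cons (t, y))) \o shift x)
    (h *: delta_mx 0 j) - f (rV_cons (t, x)))).
  apply/funext => h /=; congr (_ *: (f _ - _)); apply/rowP => i; rewrite !mxE.
  by case: unliftP => [k ->|->] /=; rewrite ?mxE ?eqxx ?(inj_eq lift_inj) ?mulr0 ?add0r.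
by move=> [fd fE]; split; [move: fd; rewrite /derivable E|rewrite -fE /derive E].
Qed.

Lemma is_derive_head f (t : R) (x : 'rV[R]_n) df :
  is_derive (rV_cons (t, x)) (delta_mx 0 0) f df ->
  is_derive t 1 (fun s => f (rV_cons (s, x))) df.
Proof.
have E : (fun h : R => h^-1 *: ((f \o shift (rV_cons (t, x)))
    (h *: delta_mx 0 0) - f (rV_cons (t, x)))) =
  (fun h : R => h^-1 *: (((fun s => f (rV_cons (s, x))) \o shift t)
    (h *: (1 : R)) - f (rV_cons (t, x)))).
  apply/funext => h /=; congr (_ *: (f _ - _)); apply/rowP => i; rewrite !mxE.
  by case: unliftP => [k ->|->] /=; rewrite ?eqxx /= ?mulr0 ?add0r.
by move=> [fd fE]; split; [move: fd; rewrite /derivable E|rewrite -fE /derive E].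
Qed.

End slices.

(** * The integral of a compactly supported partial derivative *)

Section integral_of_a_partial_derivative.
Context {R : realType}.

Lemma integral_derive_compact_support (f g : R -> R) (B : R) : 0 < B ->
  (forall t : R, is_derive t 1 f (g t)) -> continuous g ->
  (forall t, B < `|t| -> f t = 0 /\ g t = 0) ->
  (\int[@lebesgue_measure R]_t (g t)%:E)%E = 0%E.
Proof.
move=> B0 df cg fg0.
have cf : continuous f.
  by move=> t; apply: differentiable_continuous; apply/derivable1_diffP; case: (df t).
have out : forall t, t \notin `[- (B + 1), B + 1] -> g t = 0.
  move=> t; rewrite in_itv /= -ler_norml -ltNge => h; apply: (fg0 _ _).2; lra.
transitivity (\int[@lebesgue_measure R]_(t in `[(- (B + 1))%R, (B + 1)%R]) (g t)%:E)%E.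
  rewrite [RHS]integral_mkcond; apply: eq_integral => t _.
  rewrite patchE; case: ifPn => // /negP h; rewrite out //; apply/negP => h'.
  by apply: h; rewrite inE.
rewrite (@continuous_FTC2 _ g f); first last.
- by move=> t _; rewrite derive1E; apply: derive_val.
- split => [t _||].
  + by case: (df t).
  + exact/cvg_at_right_filter/cf.
  + exact/cvg_at_left_filter/cf.
- exact: continuous_subspaceT.
- lra.
have h : B < `|B + 1| by rewrite ger0_norm; lra.
by rewrite (fg0 _ h).1 (fg0 (- (B + 1)) _).1 ?normrN // subee.
Qed.

(** By Fubini's theorem the integral over the direction of differentiation can
be taken first.  The measure on dimension n + 1 singles out the first coordinate:
the fundamental theorem of calculus handles that direction, and the other ones
reduce to dimension n on each slice. *)
Lemma integral_partial_compact_support n (i : 'I_n) (f g : 'rV[R]_n -> R)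
    (K : set 'rV[R]_n) : compact K ->
  (forall x, is_derive x (delta_mx 0 i) f (g x)) -> continuous g ->
  (forall x, ~ K x -> f x = 0) ->
  (\int[lebesgue_rV n]_x (g x)%:E)%E = 0%E.
Proof.
elim: n i f g K => [[]//|n IH] i f g K cK df cg f0.
have [B B0 KB] := compact_sub_box cK.
have g0 := zero_off_compact_is_derive cK f0 df.
have ig := continuous_compact_support_integrable cK cg g0.
have mg := measurable_int _ ig.
have ig' : ((@lebesgue_measure R) \x lebesgue_rV n)%E.-integrable setT
    ((EFin \o g) \o @rV_cons R n).
  apply/integrableP; split.
    by apply: measurableT_comp => //; exact: measurable_rV_cons.
  move: ig => /integrableP[_]; rewrite /= (ge0_integral_pushforward (@measurable_rV_cons R n)) //.
  by apply/measurable_EFinP; apply: measurableT_comp => //; exact: continuous_measurable_rV.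
transitivity (\int[(@lebesgue_measure R) \x lebesgue_rV n]_x ((EFin \o g) \o @rV_cons R n) x)%E.
  exact: (integral_pushforward (@measurable_rV_cons R n) mg ig' measurableT).
case: (unliftP 0 i) => [j ij|i0].
- rewrite -integral12_prod_meas1 //; apply: integral0_eq => t _.
  rewrite /fubini_F /=.
  apply: (IH j (fun x => f (rV_cons (t, x))) (fun x => g (rV_cons (t, x)))
     [set x | forall k, x 0 k \in `[- B, B]]).
  + apply: (@rV_compact _ n (fun=> `[- B, B]%classic)) => _; exact: segment_compact.
  + by move=> x; apply: is_derive_tail; rewrite -ij.
  + move=> x; apply: (@continuous_comp _ _ _ (fun x => rV_cons (t, x)) g); last exact: cg.
    exact: rV_cons_continuous_tail.
  + move=> x xB; apply: f0 => Kx; apply: xB => k; rewrite in_itv /= -ler_norml.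
    by have := KB _ Kx (lift 0 k); rewrite mxE liftK.
- rewrite -integral21_prod_meas1 //; apply: integral0_eq => x _.
  rewrite /fubini_G /=.
  apply: (@integral_derive_compact_support (fun t => f (rV_cons (t, x)))
     (fun t => g (rV_cons (t, x))) B) => //.
  + by move=> t; apply: is_derive_head; rewrite -i0.
  + move=> t; apply: (@continuous_comp _ _ _ (fun t => rV_cons (t, x)) g); last exact: cg.
    exact: rV_cons_continuous_head.
  + move=> t Bt.
    have nK : ~ K (rV_cons (t, x)).
      by move/KB/(_ 0); rewrite mxE unlift_none /= leNgt Bt.
    by rewrite f0 // g0.
Qed.

End integral_of_a_partial_derivative.

(** * Multiplying a function by an indicator *)

Section directional_derivatives.
Context {R : realType} {V : normedModType R}.
Implicit Types (f g : V -> R) (x v : V) (A : set V).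

Lemma is_derive_cvg f x v (df : R) :
  h^-1 *: (f (h *: v + x) - f x) @[h --> (0 : R)^'] --> df -> is_derive x v f df.
Proof. by move=> h; split; [apply/cvg_ex; exists df|exact/cvg_lim]. Qed.

Lemma cvg_is_derive f x v (df : R) : is_derive x v f df ->
  h^-1 *: (f (h *: v + x) - f x) @[h --> (0 : R)^'] --> df.
Proof. by move=> [fd <-]. Qed.

End directional_derivatives.

Section patching.
Context {R : realType} {V : normedModType R}.
Implicit Types (f g : V -> R) (x v : V) (A : set V).

(** A directional derivative is an ordinary derivative along a line; this gives
access to the one-variable chain rule. *)
Lemma is_derive_line f x v (df : R) :
  is_derive (0 : R) 1 (fun h => f (h *: v + x)) df -> is_derive x v f df.
Proof.
move=> /cvg_is_derive h; apply: is_derive_cvg; move: h.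
by under eq_fun do rewrite scale0r add0r addr0 /GRing.scale /= mulr1.
Qed.

(** In other words, [x] is not a boundary point of [A]. *)
Definition locally_constant_at A x := \forall y \near x, A y <-> A x.

(** Away from the boundary of [A] the product is locally [f] or 0.  At a boundary
point where [f] and its derivative vanish, cutting [f] off only decreases the
absolute value of difference quotients that already tend to 0. *)
Lemma is_derive_patch A f (df : R) x v : is_derive x v f df ->
  locally_constant_at A x \/ f x = 0 /\ df = 0 ->
  is_derive x v (f \_ A) (if x \in A then df else 0).
Proof.
move=> fd [Ax|[fx0 df0]].
  have [xA|xA] := boolP (x \in A).
    apply: near_eq_is_derive fd; apply: filterS Ax => y Ay.
    by rewrite patchE mem_set //; apply/Ay; rewrite inE in xA.
  apply: (@near_eq_is_derive _ _ _ (cst 0)); apply: filterS Ax => y Ay.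
  by rewrite patchE memNset // => /Ay; move/negP: xA; rewrite inE.
have -> : (if x \in A then df else 0) = 0 by rewrite df0 if_same.
apply: is_derive_cvg; move/cvg_is_derive: fd; rewrite df0 fx0.
have -> : (f \_ A) x = 0 by rewrite patchE fx0 if_same.
move=> /cvgr0Pnorm_lt h; apply/cvgr0Pnorm_lt => e e0.
apply: filterS (h e e0) => t; apply: le_lt_trans.
by rewrite patchE; case: ifP => // _; rewrite subrr scaler0 normr0.
Qed.

(** The zero-order analogue of [is_derive_patch]. *)
Lemma continuous_patch A f x : {for x, continuous f} ->
  locally_constant_at A x \/ f x = 0 -> {for x, continuous (f \_ A)}.
Proof.
move=> cf [Ax|fx0].
  have [xA|xA] := boolP (x \in A).
    have E : {near x, f =1 f \_ A}.
      apply: filterS Ax => y Ay.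
      by rewrite patchE mem_set //; apply/Ay; rewrite inE in xA.
    rewrite /prop_for /continuous_at patchE xA.
    by apply: cvg_trans cf; apply: near_eq_cvg.
  rewrite /prop_for /continuous_at patchE (negbTE xA).
  apply: (@cvg_trans _ ((cst (0:R)) @ x)); last exact: cvg_cst.
  apply: near_eq_cvg; apply: filterS Ax => y Ay.
  by rewrite patchE memNset // => /Ay; move/negP: xA; rewrite inE.
rewrite /prop_for /continuous_at patchE fx0 if_same.
move: cf; rewrite /prop_for /continuous_at fx0.
move=> /cvgr0Pnorm_lt h; apply/cvgr0Pnorm_lt => e e0.
apply: filterS (h e e0) => t; apply: le_lt_trans.
by rewrite patchE; case: ifP => // _; rewrite normr0.
Qed.

End patching.

(** * Bounded functions belong to the local Lebesgue spaces *)

Section bounded_functions.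
Context {R : realType} {n : nat}.
Implicit Types (A K : set 'rV[R]_n) (f : 'rV[R]_n -> R).

Lemma bounded_Lfun K f (M p : R) : 1 <= p -> measurable K ->
  (lebesgue_rV n K < +oo)%E -> measurable_fun setT f ->
  (forall x, K x -> `|f x| <= M) -> (forall x, ~ K x -> f x = 0) ->
  f \in Lfun (lebesgue_rV n) p%:E.
Proof.
move=> p1 mK fK mf fM f0; have p0 : 0 < p by lra.
have p_neq0 : p != 0 by lra.
rewrite inE; apply/andP; split; rewrite inE //=.
rewrite /finite_norm unlock /= poweR_lty //.
apply: (@le_lt_trans _ _ (\int[lebesgue_rV n]_(x in K) (M `^ p)%:E)%E); last first.
  by rewrite integral_cst // lte_mul_pinfty // ?lee_fin ?powR_ge0 // ltry.
rewrite [leRHS]integral_mkcond; apply: ge0_le_integral => //.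
- apply/measurable_EFinP; apply: (measurableT_comp (measurable_powR _)).
  exact: measurableT_comp.
- apply/(measurable_restrictT _ _).1 => //; exact: measurable_cst.
move=> x _; rewrite patchE; case: ifPn => [|/negP xK]; rewrite ?inE.
  by move=> Kx; rewrite /= lee_fin ge0_ler_powR ?nnegrE // ?fM //; [lra|apply: le_trans (fM x Kx)].
by rewrite f0 ?normr0 ?powR0 // => Kx; apply: xK; rewrite inE.
Qed.

Lemma measurable_patch A f : measurable A -> measurable_fun setT f ->
  measurable_fun setT (f \_ A).
Proof.
move=> mA mf; apply: (measurable_restrictT _ mA).1; exact: (measurable_funTS mf).
Qed.

Lemma normr_patch_le A f x : `|(f \_ A) x| <= `|f x|.
Proof. by rewrite patchE; case: ifP => // _; rewrite normr0. Qed.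

Lemma continuous_patch_Lp_loc (G A : set 'rV[R]_n) f p : 1 <= p -> measurable A ->
  continuous f -> Lp_loc G p (f \_ A).
Proof.
move=> p1 mA cf K cK KG; have mK := compact_measurable_rV cK.
have [M KM] := continuous_bounded_on_compact cK cf.
apply: (@bounded_Lfun K _ M) => //; first exact: compact_finite_rV.
- apply: measurable_patch => //; apply: measurable_patch => //.
  exact: continuous_measurable_rV.
- move=> x Kx; rewrite (le_trans (normr_patch_le _ _ _)) //.
  by rewrite (le_trans (normr_patch_le _ _ _)) // KM.
- by move=> x Kx; rewrite patchE memNset.
Qed.

End bounded_functions.

(** * Weak derivatives of a function times an indicator *)

Section weak_derivative_of_a_patched_function.
Context {R : realType} {n : nat}.
Implicit Types (G A K : set 'rV[R]_n) (w dw : 'rV[R]_n -> R).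

(** A jump of the indicator of [A] inside [G] is harmless where [w] vanishes to
first order.  Multiplying by a test function also makes the product vanish to
first order outside of [G], so that it has a continuous classical partial
derivative everywhere, whose integral is 0. *)
Lemma weak_partial_patch G A i w dw : open G -> measurable A ->
  continuous w -> continuous dw ->
  (forall x, is_derive x (delta_mx 0 i) w (dw x)) ->
  (forall x, G x -> locally_constant_at A x \/ w x = 0 /\ dw x = 0) ->
  weak_partial G i (w \_ A) (dw \_ A).
Proof.
move=> oG mA cw cdw wd GA; split; [exact: continuous_patch_Lp_loc..|].
move=> psi [psiS [K [cK KG psi0]]].
have [cpsi dpsi] := psiS [::].
have [/= cdpsi _] := psiS [:: i].
have psid x : is_derive x (delta_mx 0 i) psi (partial i psi x) by exact/derivableP.
have dpsi0 := zero_off_compact_is_derive cK psi0 psid.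
pose F := w \* psi; pose dF x := w x * partial i psi x + psi x * dw x.
have Fd x : is_derive x (delta_mx 0 i) F (dF x).
  exact: (is_deriveM (wd x) (psid x)).
have cF : continuous F by move=> x; exact: (cvgM (cw x) (cpsi x)).
have cdF : continuous dF.
  by move=> x; exact: (cvgD (cvgM (cw x) (cdpsi x)) (cvgM (cpsi x) (cdw x))).
have F0 x : ~ K x -> F x = 0 by move=> /psi0 h; rewrite /F /= h mulr0.
have dF0 x : ~ K x -> dF x = 0.
  move=> Kx; rewrite /dF dpsi0 // psi0 //; ring.
(* The boundary of A may be wild outside of G, but psi vanishes there. *)
have good x : locally_constant_at A x \/ F x = 0 /\ dF x = 0.
  have [Kx|Kx] := pselect (K x); last by right; rewrite F0 // dF0.
  have [h|[w0 dw0]] := GA x (KG _ Kx); [by left|right].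
  by rewrite /F /= /dF w0 dw0; split; ring.
have FA0 x : ~ K x -> (F \_ A) x = 0 by move=> Kx; rewrite patchE F0 // if_same.
have dFA0 x : ~ K x -> (dF \_ A) x = 0 by move=> Kx; rewrite patchE dF0 // if_same.
have dFAd x : is_derive x (delta_mx 0 i) (F \_ A) ((dF \_ A) x).
  by have := is_derive_patch (Fd x) (good x); rewrite patchE.
have cdFA : continuous (dF \_ A).
  move=> x; apply: continuous_patch; first exact: cdF.
  by have [|[]] := good x; [left|right].
have I0 := integral_partial_compact_support cK dFAd cdFA FA0.
have mG := open_measurable_rV oG.
have iG (f g : 'rV[R]_n -> R) : continuous f -> continuous g -> (forall x, ~ K x -> g x = 0) ->
    (lebesgue_rV n).-integrable G (EFin \o (f \_ A \* g)).
  move=> cf cg g0.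
  have cfg : continuous (f \* g) by move=> x; exact: (cvgM (cf x) (cg x)).
  have fg0 x : ~ K x -> (f \* g) x = 0 by move=> Kx; rewrite /= g0 // mulr0.
  have iA : (lebesgue_rV n).-integrable A (EFin \o (f \* g)).
    by apply: integrableS (continuous_compact_support_integrable cK cfg fg0).
  have iT : (lebesgue_rV n).-integrable setT ((EFin \o (f \* g)) \_ A).
    by rewrite -integrable_mkcond.
  have := @integrableS _ _ _ _ _ G _ measurableT mG (@subsetT _ G) iT.
  congr (_.-integrable _ _); apply/funext => x /=; rewrite !patchE.
  by case: ifP => // _; rewrite mul0r.
have split : \int[lebesgue_rV n]_(x in G) ((w \_ A) x * partial i psi x) +
    \int[lebesgue_rV n]_(x in G) ((dw \_ A) x * psi x) = 0.
  rewrite -RintegralD //=; last 2 first.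
  - exact: (iG w (partial i psi)).
  - exact: (iG dw psi).
  rewrite -[RHS]/(fine 0) -I0; congr fine; rewrite integral_mkcond.
  apply: eq_integral => x _; rewrite patchE; case: ifPn => xG.
    by congr EFin; rewrite !patchE; case: ifP => _; rewrite /dF ?mul0r ?addr0 // (mulrC (psi x)).
  rewrite dFA0 // => /KG Gx; move/negP: xG; apply; exact/mem_set.
by apply/eqP; rewrite -subr_eq0 opprK; apply/eqP.
Qed.

End weak_derivative_of_a_patched_function.

(** * A continuously differentiable step *)

Section smooth_step.
Context {R : realType}.
Implicit Types t : R.

Definition pos_part t := Num.max t 0.

(** The second difference with step 1/2 of the squared positive part, which is
C^1: a quadratic spline that goes from 0 at 0 to 1/2 at 1. *)
Definition smooth_step t :=
  pos_part t ^+ 2 - 2 * pos_part (t - 2^-1) ^+ 2 + pos_part (t - 1) ^+ 2.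

(** The derivative of [smooth_step]: the tent function with height 1 over [0, 1]. *)
Definition smooth_step' t :=
  2 * pos_part t - 4 * pos_part (t - 2^-1) + 2 * pos_part (t - 1).

Lemma pos_partE t : pos_part t = if t <= 0 then 0 else t.
Proof. by rewrite /pos_part; case: leP. Qed.

Lemma is_derive_pos_part_sqr t : is_derive t (1:R) (fun s => pos_part s ^+ 2) (2 * pos_part t).
Proof.
have [t0|t0|->] := ltgtP t 0.
- rewrite pos_partE (ltW t0) mulr0; apply: (@near_eq_is_derive _ _ _ (cst 0)).
  have : nbhs t [set s : R | s < 0] by apply: open_nbhs_nbhs; split=> //; exact: open_lt.
  by apply: filterS => s /= s0; rewrite pos_partE ltW // expr0n.
- rewrite pos_partE leNgt t0 /=; apply: (@near_eq_is_derive _ _ _ (fun s : R => s ^+ 2)).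
  have : nbhs t [set s : R | 0 < s] by apply: open_nbhs_nbhs; split=> //; exact: open_gt.
  by apply: filterS => s /= s0; rewrite pos_partE leNgt s0.
    apply: (is_derive_eq (is_deriveX 2 (is_derive_id t 1))).
  by rewrite /GRing.scale /= expr1 mulr1.
rewrite pos_partE lexx mulr0; apply: is_derive_cvg.
rewrite pos_partE lexx; apply/cvgr0Pnorm_lt => e e0.
exists e => //= h; rewrite /= sub0r normrN => he h0.
rewrite /GRing.scale /= mulr1 addr0 expr0n subr0 normrM normfV normrX.
rewrite pos_partE; case: ifP => _; first by rewrite normr0 expr0n mulr0.
by rewrite expr2 mulrA mulVf ?mul1r // normr_eq0.
Qed.

Lemma is_derive_smooth_step t : is_derive t (1:R) smooth_step (smooth_step' t).
Proof.
have shifted a : is_derive t (1:R) (fun s => pos_part (s - a) ^+ 2) (2 * pos_part (t - a)).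
  apply: (is_derive_eq (@is_derive1_comp _ (fun s => pos_part s ^+ 2) (shift (- a)) t _ 1 _ _)).
  - exact: is_derive_pos_part_sqr.
  - exact: is_derive_shift.
  - by rewrite mulr1.
apply: (is_derive_eq (is_deriveD (is_deriveB (is_derive_pos_part_sqr t)
  (is_deriveZ 2 (shifted 2^-1))) (shifted 1))).
by rewrite /smooth_step' /GRing.scale /= mulrA -natrM.
Qed.

Lemma pos_part_continuous : continuous pos_part.
Proof.
move=> t; apply: (@continuous_max _ _ id (cst (0 : R))); [exact: cvg_id|exact: cvg_cst].
Qed.

Lemma smooth_step'_continuous : continuous smooth_step'.
Proof.
have shift a t : {for t, continuous (fun s => pos_part (s - a))}.
  apply: (@continuous_comp _ _ _ (fun s => s - a) pos_part); last exact: pos_part_continuous.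
  by apply: cvgB; [exact: cvg_id|exact: cvg_cst].
move=> t; apply: cvgD; first apply: cvgB; apply: cvgMl_tmp.
- exact: pos_part_continuous.
- exact: shift.
- exact: shift.
Qed.

Lemma smooth_step_le0 t : t <= 0 -> smooth_step t = 0 /\ smooth_step' t = 0.
Proof.
move=> t0; rewrite /smooth_step /smooth_step' !pos_partE t0.
have -> : t - 2^-1 <= 0 by lra.
have -> : t - 1 <= 0 by lra.
by split; ring.
Qed.

Lemma smooth_step_ge1 t : 1 <= t -> smooth_step t = 2^-1 /\ smooth_step' t = 0.
Proof.
move=> t1; rewrite /smooth_step /smooth_step' /pos_part !max_l; lra.
Qed.

Lemma smooth_step_bounds t : 0 <= smooth_step t <= 2^-1.
Proof.
rewrite /smooth_step !pos_partE.
have [?|?] := leP t 0; have [?|?] := leP (t - 2^-1) 0; have [?|?] := leP (t - 1) 0;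
  apply/andP; split; nra.
Qed.

Lemma smooth_step'_bounds t : 0 <= smooth_step' t <= 1.
Proof.
rewrite /smooth_step' !pos_partE.
have [?|?] := leP t 0; have [?|?] := leP (t - 2^-1) 0; have [?|?] := leP (t - 1) 0;
  apply/andP; split; lra.
Qed.

Lemma smooth_step'_lower t : 4^-1 <= t <= 3 / 4 -> 2^-1 <= smooth_step' t.
Proof.
move=> /andP[? ?]; rewrite /smooth_step' !pos_partE.
have [?|?] := leP t 0; have [?|?] := leP (t - 2^-1) 0; have [?|?] := leP (t - 1) 0;
  lra.
Qed.

End smooth_step.

(** * Boxes and their interiors *)

Section boxes.
Context {R : realType} {n : nat}.

(** The concentric box with half the sides.  If the sides are positive, it lies in
the interior of the box, hence in the domain when the box is one of its pieces. *)
Definition half_box (a l : 'rV[R]_n) := box (a + 4^-1 *: l) (2^-1 *: l).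

Lemma half_box_sub_interior (a l : 'rV[R]_n) : (forall i, 0 < l 0 i) ->
  half_box a l `<=` (box a l)°.
Proof.
move=> l0 x xb; have near_coord i : nbhs x [set y : 'rV[R]_n | a 0 i <= y 0 i <= a 0 i + l 0 i].
  have : nbhs x ((fun y : 'rV[R]_n => y 0 i) @^-1` `]a 0 i, (a 0 i + l 0 i)[%classic).
    apply: coord_continuous; apply: open_nbhs_nbhs; split; first exact: itv_open.
    by rewrite /= in_itv /=; have := xb i; have := l0 i; rewrite !mxE; lra.
  by apply: filterS => y /=; rewrite in_itv /= => /andP[/ltW -> /ltW ->].
exact: filter_forall near_coord.
Qed.

Lemma lebesgue_half_box (a l : 'rV[R]_n) : (forall i, 0 < l 0 i) ->
  lebesgue_rV n (half_box a l) = (\prod_i (l 0 i / 2))%:E.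
Proof.
move=> l0; rewrite lebesgue_rV_box => [|i]; last by have := l0 i; rewrite mxE; lra.
by congr EFin; apply: eq_bigr => i _; rewrite mxE mulrC.
Qed.

Lemma half_box_sub_box (a l : 'rV[R]_n) : (forall i, 0 < l 0 i) ->
  half_box a l `<=` box a l.
Proof. by move=> l0 x /(half_box_sub_interior l0)/interior_subset. Qed.

End boxes.

(** * The geometry of a mushrooms-type domain *)

Section mushroom_geometry.
Context {R : realType} {n : nat} (hn : (2 <= n)%N) (phi : R -> R).
Hypothesis phi_gt0 : forall t, 0 < t -> 0 < phi t.
Variables (r : nat -> R) (a b : nat -> 'rV[R]_n).
Hypothesis rab : mushrooms hn phi r a b.

Let x2 := snd_coord hn.

Definition mushroom m := cap r a m `|` stem hn phi r b m.

Let r0 m : 0 < r m := mushrooms_gt0 rab m.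
Let phi0 m : 0 < phi (r m) := phi_gt0 (r0 m).

Lemma cap_sides_gt0 m i : 0 < @cap_sides R n (r m) 0 i.
Proof. by have := r0 m; rewrite mxE; lra. Qed.

Lemma stem_sides_gt0 m i : 0 < stem_sides hn phi (r m) 0 i.
Proof. by have := r0 m; have := phi0 m; rewrite mxE; case: ifP => _; lra. Qed.

(** The top face of the stem has positive width in each horizontal direction, so
that it fits only in a horizontal face of the cap; the cap lies above it, so that
this is the bottom face. *)
Lemma cap_bottom m : a m 0 x2 = 1 + r m.
Proof.
have [F [i Fi] top] := mushrooms_cap_attached rab m.
have above : 1 + r m <= a m 0 x2.
  apply: (mushrooms_cap_above rab (m := m)) => j.
  by have := cap_sides_gt0 m j; rewrite lexx /=; lra.
have bot := mushrooms_stem_bottom rab m.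
(* p k is the corner of the top of the stem shifted along the axis k by the
   width of the stem; for k = x2 there is no shift. *)
pose p k : 'rV[R]_n := \row_j (b m 0 j +
  (if j == x2 then r m else if j == k then 2 * phi (r m) else 0)).
have pF k : F (p k).
  apply: top; split=> [j|/=]; rewrite !mxE ?eqxx; last by rewrite bot.
  have := r0 m; have := phi0 m.
  by case: ifP => _; [|case: ifP => _]; lra.
have pp : forall k, p k 0 i = a m 0 i \/ p k 0 i = a m 0 i + 2 * r m.
  by move=> k; have := pF k; case: Fi => -> [_ /=] ->; [left|right; rewrite mxE].
have ppp : p i 0 i = p x2 0 i.
  by have := pF i; have := pF x2; case: Fi => -> [_ /= ->] [_ /= ->].
have ix2 : i = x2.
  apply/eqP/negP => /negP/negbTE ine; move: ppp; rewrite !mxE ine eqxx.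
  by have := phi0 m; lra.
by have := pp x2; rewrite mxE ix2 eqxx bot; have := r0 m; lra.
Qed.

(** This is what makes the family of mushrooms locally finite above the
hyperplane: a mushroom that reaches height 1 + d has radius at least d/3. *)
Lemma mushroom_height m x : mushroom m x -> 1 <= x 0 x2 <= 1 + 3 * r m.
Proof.
have := r0 m => rm; case=> /(_ x2).
  by rewrite cap_bottom mxE; lra.
by rewrite (mushrooms_stem_bottom rab) mxE eqxx; lra.
Qed.

Lemma mushroom_below_cap m x : mushroom m x -> x 0 x2 < 1 + r m -> stem hn phi r b m x.
Proof. by case=> // /(mushrooms_cap_above rab) /=; rewrite leNgt => /negP. Qed.

Lemma mushroom_closed m : closed (mushroom m).
Proof. by apply: closedU; exact: box_closed. Qed.

Lemma mushroom_measurable m : measurable (mushroom m).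
Proof. by apply: closed_measurable_rV; exact: mushroom_closed. Qed.

Definition mushrooms_interior := (unit_cube `|` \bigcup_m (cap r a m `|` stem hn phi r b m `|`
        (Defs.reflect hn @` cap r a m) `|` (Defs.reflect hn @` stem hn phi r b m)))°.

Lemma reflected_height m x :
  (Defs.reflect hn @` cap r a m `|` Defs.reflect hn @` stem hn phi r b m) x -> x 0 x2 <= 0.
Proof.
have le0 y : mushroom m y -> Defs.reflect hn y 0 x2 <= 0.
  by move=> /mushroom_height; rewrite mxE eqxx; lra.
by case=> -[y yM <-]; apply: le0; [left|right].
Qed.

Lemma above_in_mushroom x : mushrooms_interior x -> 1 < x 0 x2 -> exists m, mushroom m x.
Proof.
move=> /interior_subset [/(_ x2)|[m _ [[?|rx]|rx]]] h.
- by move: h; rewrite !mxE; lra.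
- by exists m.
- by have := reflected_height (or_introl rx); lra.
- by have := reflected_height (or_intror rx); lra.
Qed.

(** Near a point of the domain above the hyperplane all but finitely many
mushrooms are too low to matter.  The finitely many others are closed and pairwise
disjoint, so that a small ball meets at most the one through its centre. *)
Lemma mushroom_locally_constant m x : mushrooms_interior x -> 1 < x 0 x2 ->
  locally_constant_at (mushroom m) x.
Proof.
move=> Gx x1; have off j : ~ mushroom j x -> \forall y \near x, ~ mushroom j y.
  move=> nx; apply: (@open_nbhs_nbhs _ x (~` mushroom j)); split=> //.
  by apply: closed_openC; exact: mushroom_closed.
have [Mx|nMx] := pselect (mushroom m x); last first.
  by apply: filterS (off m nMx) => y ?; split.
pose d := (x 0 x2 - 1) / 2.
have d0 : 0 < d by rewrite /d; lra.
have [J rJ] : exists J, forall j, (J <= j)%N -> 3 * r j < d.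
  have /cvgr0Pnorm_lt/(_ (d / 3)) := mushrooms_cvg rab.
  case; first by lra.
  move=> J _ rJ; exists J => j Jj; have := rJ j Jj.
  by rewrite /= ger0_norm ?ltW //; lra.
have offJ : \forall y \near x, forall j : 'I_J, (j : nat) <> m -> ~ mushroom j y.
  suff near_j (j : 'I_J) : nbhs x [set y | (j : nat) <> m -> ~ mushroom j y].
    exact: filter_forall near_j.
  have [jm|jm] := pselect ((j : nat) = m).
    by apply: (@filterS _ (nbhs x) _ setT); [move=> y _ /(_ jm)|exact: filterT].
  have : ~ mushroom j x.
    by move=> Mjx; apply: jm; apply: (mushrooms_disjoint rab) => //; exists x.
  by move=> /off; apply: filterS => y ? _.
have nG : nbhs x mushrooms_interior.
  by apply: open_nbhs_nbhs; split=> //; exact: open_interior.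
have n1 : nbhs x ((fun y : 'rV[R]_n => y 0 x2) @^-1` [set s | 1 + d < s]).
  apply: coord_continuous.
  apply: (@open_nbhs_nbhs _ (x 0 x2) [set s | 1 + d < s]); split; first exact: open_gt.
  by rewrite /= /d; lra.
near=> y; split=> // _.
have y1 : 1 + d < y 0 x2 by near: y.
have [j Mjy] : exists j, mushroom j y.
  by apply: above_in_mushroom; [near: y|lra].
have [<-//|jm] := pselect (j = m).
have [jJ|/rJ] := ltnP j J; last by have := mushroom_height Mjy; lra.
exfalso; have /(_ (Ordinal jJ) jm) : forall j : 'I_J, (j : nat) <> m -> ~ mushroom j y by near: y.
exact.
Unshelve. all: by end_near. Qed.

Lemma half_cap_sub_domain m : half_box (a m) (@cap_sides R n (r m)) `<=` mushrooms_interior.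
Proof.
move=> x /(half_box_sub_interior (cap_sides_gt0 m)); apply: interiorS => y yc.
by right; exists m => //; left; left; left.
Qed.

Lemma half_stem_sub_domain m :
  half_box (b m) (stem_sides hn phi (r m)) `<=` mushrooms_interior.
Proof.
move=> x /(half_box_sub_interior (stem_sides_gt0 m)); apply: interiorS => y yc.
by right; exists m => //; left; left; right.
Qed.

Lemma lebesgue_cap m : lebesgue_rV n (cap r a m) = ((2 * r m) ^+ n)%:E.
Proof.
rewrite lebesgue_rV_box => [|i]; last exact/ltW/cap_sides_gt0.
under eq_bigr do rewrite mxE.
by rewrite prodr_const card_ord.
Qed.

Lemma prod_stem_sides m (f : R -> R) :
  \prod_i f (stem_sides hn phi (r m) 0 i) = f (r m) * f (2 * phi (r m)) ^+ n.-1.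
Proof.
rewrite (bigD1 x2) //= mxE eqxx; congr (_ * _).
under eq_bigr => i ix do rewrite mxE (negbTE ix).
rewrite prodr_const; congr (_ ^+ _).
by rewrite (@eq_card _ _ (predC1 x2)) ?cardC1 ?card_ord.
Qed.

Lemma lebesgue_stem m :
  lebesgue_rV n (stem hn phi r b m) = (r m * (2 * phi (r m)) ^+ n.-1)%:E.
Proof.
rewrite lebesgue_rV_box => [|i]; last exact/ltW/stem_sides_gt0.
by rewrite (prod_stem_sides m id).
Qed.

Lemma lebesgue_mushroom_le m : (lebesgue_rV n (mushroom m) <= (2 * (2 * r m) ^+ n)%:E)%E.
Proof.
apply: le_trans (measureU2 _ _ _) _; [exact: box_measurable|exact: box_measurable|].
rewrite [X in (X + _ <= _)%E]lebesgue_cap [X in (_ + X <= _)%E]lebesgue_stem.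
rewrite -EFinD lee_fin [leRHS]mulr_natl mulr2n lerD2l.
have phir := mushrooms_phi rab m; have rm := r0 m; have phim := phi0 m.
rewrite -{2}(prednK (leq_trans (isT : (0 < 2)%N) hn)) exprS.
apply: ler_pM => //; [lra|by apply: exprn_ge0; lra|lra|].
by apply: lerXn2r; rewrite ?nnegrE; lra.
Qed.

End mushroom_geometry.

(** * The function that climbs one stem *)

Section test_function.
Context {R : realType} {n : nat} (hn : (2 <= n)%N) (phi : R -> R).
Hypothesis phi_gt0 : forall t, 0 < t -> 0 < phi t.
Variables (r : nat -> R) (a b : nat -> 'rV[R]_n).
Hypothesis rab : mushrooms hn phi r a b.
Variables (p : R) (m : nat).
Hypothesis p1 : 1 <= p.

Let x2 := snd_coord hn.
Let G := mushrooms_interior hn phi r a b.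
Let M := mushroom hn phi r a b m.
Let mu : {sigma_finite_measure set 'rV[R]_n -> \bar R} := lebesgue_rV n.

Let r0 : 0 < r m := mushrooms_gt0 rab m.
Let phi0 : 0 < phi (r m) := phi_gt0 r0.
Let p0 : 0 < p. Proof. exact: lt_le_trans ltr01 p1. Qed.
Let p_neq0 : p != 0. Proof. by rewrite gt_eqF. Qed.
Let mM : measurable M. Proof. exact: mushroom_measurable. Qed.
Let oG : open G. Proof. exact: open_interior. Qed.
Let mG : measurable G. Proof. exact: open_measurable_rV. Qed.
Let Mfin : (mu M < +oo)%E.
Proof. by apply: le_lt_trans (lebesgue_mushroom_le phi_gt0 rab m) _; exact: ltry. Qed.

Definition level (x : 'rV[R]_n) := (x 0 x2 - 1) / r m.

Definition stem_step c (x : 'rV[R]_n) := c * smooth_step (level x).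

Definition stem_step' c (i : 'I_n) (x : 'rV[R]_n) :=
  if i == x2 then c * (smooth_step' (level x) / r m) else 0.

Definition cap_function c := stem_step c \_ M.

Definition cap_gradient c (x : 'rV[R]_n) : 'rV[R]_n :=
  \row_i (stem_step' c i \_ M) x.

Lemma level_continuous : continuous level.
Proof.
move=> /= x; have h : (fun y : 'rV[R]_n => y 0 x2 - 1) @ x --> x 0 x2 - 1.
  by apply: (cvgB (@coord_continuous _ _ _ 0 x2 x)); exact: cvg_cst.
by apply: (cvgMr_tmp h).
Qed.

Lemma is_derive_stem_step c i x :
  is_derive x (delta_mx 0 i) (stem_step c) (stem_step' c i x).
Proof.
apply: is_derive_line.
have [ix|ix] := eqVneq i x2; last first.
  rewrite /stem_step' (negbTE ix).
  have -> : (fun h : R => stem_step c (h *: delta_mx 0 i + x)) = cst (stem_step c x).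
    apply/funext => h.
    by rewrite /stem_step /level !mxE eq_sym (negbTE ix) andbF mulr0 add0r.
  exact: is_derive_cst.
rewrite /stem_step' ix eqxx.
have d1 : is_derive (0 : R) (1 : R) (fun h => level (h *: delta_mx 0 x2 + x)) (r m)^-1.
  have -> : (fun h : R => level (h *: delta_mx 0 x2 + x)) =
      (r m)^-1 *: (id : R -> R) + cst (level x).
    apply/funext => h; rewrite /level !mxE !eqxx /= mulr1.
    rewrite -[RHS]/((r m)^-1 * h + (x 0 x2 - 1) / r m); lra.
  apply: (is_derive_eq (is_deriveD (is_deriveZ (r m)^-1 (is_derive_id (0:R) (1:R)))
    (is_derive_cst (level x) (0:R) (1:R)))).
  by rewrite addr0 /GRing.scale /= mulr1.
have d2 : is_derive (level (0 *: delta_mx 0 x2 + x)) (1 : R) (c *: smooth_step)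
    (c * smooth_step' (level x)).
  rewrite scale0r add0r; exact: (is_deriveZ c (is_derive_smooth_step _)).
have := @is_derive1_comp _ (c *: smooth_step) (fun h => level (h *: delta_mx 0 x2 + x)) 0 _ _ d2 d1.
by rewrite -mulrA.
Qed.

Lemma stem_step_continuous c : continuous (stem_step c).
Proof.
move=> /= x; have cs : {for level x, continuous (@smooth_step R)}.
  apply: differentiable_continuous; apply/derivable1_diffP.
  by case: (is_derive_smooth_step (level x)).
by apply: (cvgMl_tmp (a := c) (continuous_comp (@level_continuous x) cs)).
Qed.

Lemma stem_step'_continuous c i : continuous (stem_step' c i).
Proof.
rewrite /stem_step'; case: (i == x2) => /= x; last by apply: (@cst_continuous _ _ (0 : R) x).
have cs := continuous_comp (@level_continuous x) (@smooth_step'_continuous R (level x)).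
have cs' := cvgMr_tmp (b := (r m)^-1) cs.
by apply: (cvgMl_tmp (a := c) (cs' _)).
Qed.

(** This first-order vanishing is the reason for a C^1 step: it covers the points
of the domain on the hyperplane, across which the indicator of the mushroom jumps. *)
Lemma stem_step_below c i (x : 'rV[R]_n) : x 0 x2 <= 1 ->
  stem_step c x = 0 /\ stem_step' c i x = 0.
Proof.
move=> x1; have [s0 s0'] : smooth_step (level x) = 0 /\ smooth_step' (level x) = 0.
  by apply: smooth_step_le0; rewrite /level pmulr_lle0 ?invr_gt0 //; lra.
by rewrite /stem_step /stem_step' s0 s0' mulr0; split=> //; case: ifP; rewrite ?mul0r ?mulr0.
Qed.

(** Above the hyperplane the mushroom is open and closed in the domain; on the
hyperplane and below it the step vanishes to first order. *)
Lemma cap_function_weak_gradient c : weak_gradient G (cap_function c) (cap_gradient c).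
Proof.
move=> i; rewrite (_ : (fun x => cap_gradient c x 0 i) = stem_step' c i \_ M); last first.
  by apply/funext => x; rewrite mxE.
apply: weak_partial_patch => //.
- exact: stem_step_continuous.
- exact: stem_step'_continuous.
- by move=> x; exact: is_derive_stem_step.
move=> x Gx; have [x1|x1] := leP (x 0 x2) 1; first by right; exact: stem_step_below.
by left; exact: mushroom_locally_constant.
Qed.

Lemma stem_step'_bound c i (x : 'rV[R]_n) : `|stem_step' c i x| <= `|c| / r m.
Proof.
rewrite /stem_step'; case: ifP => _; last by rewrite normr0 divr_ge0 // ltW.
rewrite normrM normrM normfV (gtr0_norm r0) mulrA ler_pM2r ?invr_gt0 //.
rewrite ler_piMr //; have := smooth_step'_bounds (level x) => /andP[? ?].
by rewrite ger0_norm.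
Qed.

Lemma cap_gradient_Lp c i : Lp_space G p (fun x => cap_gradient c x 0 i).
Proof.
apply: (@bounded_Lfun _ _ M _ (`|c| / r m)) => //.
- apply: measurable_patch => //.
  rewrite (_ : (fun x => _) = stem_step' c i \_ M); last first.
    by apply/funext => x; rewrite mxE.
  apply: measurable_patch => //; apply: continuous_measurable_rV.
  exact: stem_step'_continuous.
- move=> x _; rewrite (le_trans (normr_patch_le _ _ _)) // mxE.
  rewrite (le_trans (normr_patch_le _ _ _)) //; exact: stem_step'_bound.
- by move=> x Mx; rewrite patchE; case: ifP => // _; rewrite mxE patchE memNset.
Qed.

Lemma cap_function_L1p c : L1p G p (cap_function c).
Proof.
split; first by apply: continuous_patch_Lp_loc => //; exact: stem_step_continuous.
exists (cap_gradient c); first exact: cap_function_weak_gradient.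
exact: cap_gradient_Lp.
Qed.

Lemma cap_function_measurable c : measurable_fun setT (cap_function c).
Proof.
apply: measurable_patch => //; apply: continuous_measurable_rV.
exact: stem_step_continuous.
Qed.

Lemma cap_function_bound c (x : 'rV[R]_n) : 0 <= c -> 0 <= cap_function c x <= c / 2.
Proof.
move=> c0; rewrite /cap_function patchE; case: ifP => _; last by rewrite lexx /= divr_ge0.
have := smooth_step_bounds (level x) => /andP[s0 s1].
by rewrite mulr_ge0 //= ler_wpM2l.
Qed.

Lemma cap_function_cap c (x : 'rV[R]_n) : cap r a m x -> cap_function c x = c / 2.
Proof.
move=> xc; rewrite /cap_function patchE mem_set; last by left.
have := mushrooms_cap_above rab xc => /= x1.
rewrite /stem_step (smooth_step_ge1 _).1 //.
by rewrite /level ler_pdivlMr //; rewrite -/x2 in x1; lra.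
Qed.

Lemma cap_function_integrable c : mu.-integrable G (EFin \o cap_function c).
Proof.
have bounded x : `|cap_function c x| <= `|c| / 2.
  rewrite (le_trans (normr_patch_le _ _ _)) // normrM ler_wpM2l //.
  by have := smooth_step_bounds (level x) => /andP[? ?]; rewrite ger0_norm.
suff iT : mu.-integrable setT (EFin \o cap_function c) by apply: integrableS iT.
have capM : cap_function c \_ M = cap_function c.
  apply/funext => x; rewrite [LHS]patchE; case: ifP => //.
  by rewrite /cap_function patchE => ->.
have := bounded_integrable_rV mM Mfin (measurable_funTS (cap_function_measurable c))
  (fun x _ => bounded x).
by rewrite integrable_mkcond // restrict_EFin capM.
Qed.

Lemma eucl_norm_cap_gradient c (x : 'rV[R]_n) :
  eucl_norm (cap_gradient c x) = `|(stem_step' c x2 \_ M) x|.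
Proof.
rewrite /eucl_norm (bigD1 x2) //= mxE big1 ?addr0 ?sqrtr_sqr // => i ix.
by rewrite mxE patchE /stem_step' (negbTE ix) if_same expr0n.
Qed.

(** The x_2-component of the gradient for [c = 1], extended by 0. *)
Definition steepness (x : 'rV[R]_n) := ((stem_step' 1 x2 \_ M) \_ G) x.

Definition energy := (\int[mu]_x (`|steepness x| `^ p)%:E)%E.

Lemma steepness_powR_measurable :
  measurable_fun setT (fun x => (`|steepness x| `^ p)%:E).
Proof.
apply/measurable_EFinP; apply: (measurableT_comp (measurable_powR _)).
apply: measurableT_comp => //; apply: measurable_patch => //.
apply: measurable_patch => //; apply: continuous_measurable_rV.
exact: stem_step'_continuous.
Qed.

Lemma steepness_off_stem x : ~ stem hn phi r b m x -> steepness x = 0.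
Proof.
move=> nS; rewrite /steepness patchE; case: ifP => // _; rewrite patchE.
case: ifPn => //; rewrite inE => Mx; rewrite /stem_step' eqxx.
have [x1|x1] := ltP (x 0 x2) (1 + r m); first by case: nS; exact: mushroom_below_cap Mx x1.
by rewrite (smooth_step_ge1 _).2 ?mul0r ?mulr0 // /level ler_pdivlMr //; lra.
Qed.

(** The gradient vanishes off the stem, and is at most 1/r on it. *)
Lemma energy_le : (energy <= ((r m)^-1 `^ p * (r m * (2 * phi (r m)) ^+ n.-1))%:E)%E.
Proof.
have mS : measurable (stem hn phi r b m) by exact: box_measurable.
apply: (@le_trans _ _ (\int[mu]_(x in stem hn phi r b m) ((r m)^-1 `^ p)%:E)%E).
  rewrite [leRHS]integral_mkcond; apply: ge0_le_integral => //.
  - exact: steepness_powR_measurable.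
  - apply: (measurable_restrictT _ mS).1; exact: measurable_cst.
  move=> x _; rewrite patchE; case: ifPn => [xS|]; last first.
    by move/negP; rewrite inE => nS; rewrite steepness_off_stem // normr0 powR0.
  rewrite lee_fin ge0_ler_powR ?nnegrE ?invr_ge0 ?(ltW p0) ?(ltW r0) //.
  do 2 (rewrite (le_trans (normr_patch_le _ _ _)) //).
  by have := stem_step'_bound 1 x2 x; rewrite normr1 mul1r.
rewrite integral_cst // EFinM; apply: lee_wpmul2l; first by rewrite lee_fin powR_ge0.
by rewrite le_eqVlt; apply/orP; left; apply/eqP; exact: (lebesgue_stem phi_gt0 rab).
Qed.

(** On the concentric half of the stem, [level] is between 1/4 and 3/4, and the
slope of the step is at least 1/2 there. *)
Lemma energy_gt0 : (0 < energy)%E.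
Proof.
have mH : measurable (half_box (b m) (stem_sides hn phi (r m))) by exact: box_measurable.
apply: (@lt_le_trans _ _ (\int[mu]_(x in half_box (b m) (stem_sides hn phi (r m)))
    ((2 * r m)^-1 `^ p)%:E)%E).
  rewrite integral_cst // mule_gt0 // ?lte_fin ?powR_gt0 ?invr_gt0 ?mulr_gt0 //.
  rewrite [X in (_ < X)%E]lebesgue_half_box; last exact: (stem_sides_gt0 phi_gt0 rab).
  rewrite lte_fin; apply: prodr_gt0 => i _; apply: divr_gt0 => //.
  exact: (stem_sides_gt0 phi_gt0 rab).
rewrite [leLHS]integral_mkcond; apply: ge0_le_integral => //.
- by move=> x _; rewrite patchE; case: ifP => // _; rewrite lee_fin powR_ge0.
- apply: (measurable_restrictT _ mH).1; exact: measurable_cst.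
- exact: steepness_powR_measurable.
move=> x _; rewrite patchE; case: ifPn => [|_]; last by rewrite lee_fin powR_ge0.
rewrite inE => xH; have r_neq0 : r m != 0 by rewrite gt_eqF.
have r2 : 0 <= (2 * r m)^-1 by rewrite invr_ge0 mulr_ge0 // ltW.
rewrite lee_fin ge0_ler_powR ?nnegrE ?(ltW p0) //.
have xS : stem hn phi r b m x by apply: half_box_sub_box xH; exact: (stem_sides_gt0 phi_gt0 rab).
have xG : G x by exact: (half_stem_sub_domain phi_gt0 rab) xH.
rewrite /steepness patchE mem_set // patchE mem_set; last by right.
rewrite /stem_step' eqxx mul1r invfM; apply: le_trans (ler_norm _).
rewrite ler_wpM2r ?invr_ge0 ?(ltW r0) //; apply: smooth_step'_lower.
have := xH x2; rewrite !mxE eqxx (mushrooms_stem_bottom rab) /level.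
by rewrite ler_pdivlMr // ler_pdivrMr //; lra.
Qed.

(** The norm of the gradient for [c = 1]; its inverse is the normalizing constant. *)
Definition gradient_norm := fine energy `^ p^-1.

Let energy_fin : energy = (fine energy)%:E.
Proof.
rewrite fineK // ge0_fin_numE; last exact/ltW/energy_gt0.
by apply: le_lt_trans energy_le _; exact: ltry.
Qed.

Lemma fine_energy_gt0 : 0 < fine energy.
Proof. by rewrite -lte_fin -energy_fin energy_gt0. Qed.

Lemma gradient_norm_gt0 : 0 < gradient_norm.
Proof. by rewrite powR_gt0 // fine_energy_gt0. Qed.

Lemma Lp_norm_cap_gradient c : 0 <= c ->
  Lp_norm G p (cap_gradient c) = (c * gradient_norm)%:E.
Proof.
move=> c0; rewrite /Lp_norm unlock.
transitivity (((c `^ p)%R%:E * energy) `^ p^-1)%E; last first.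
  rewrite energy_fin -EFinM poweR_EFin powRM ?powR_ge0 ?(ltW fine_energy_gt0) //.
  by rewrite -powRrM mulfV // powRr1.
congr (_ `^ _)%E; rewrite -ge0_integralZl //; first last.
- by rewrite lee_fin powR_ge0.
- exact: steepness_powR_measurable.
apply: eq_integral => x _ /=; rewrite -EFinM -powRM //; congr EFin; congr powR.
rewrite /steepness !patchE; case: ifP => _; last by rewrite normr0 mulr0.
rewrite /= eucl_norm_cap_gradient patchE; case: ifP => _; last by rewrite !normr0 mulr0.
by rewrite /stem_step' eqxx normr_id !normrM normr1 mul1r (ger0_norm c0) mulrA.
Qed.

(** The powers of r cancel out: r^-p times the volume of the stem times
r^(p-1) / phi(r)^(n-1) is 2^(n-1). *)
Lemma gradient_norm_le :
  gradient_norm * ((r m `^ (p - 1)) / phi (r m) ^+ n.-1) `^ p^-1 <= 2 ^+ n.-1.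
Proof.
have phin0 : 0 < phi (r m) ^+ n.-1 by exact: exprn_gt0.
have rp0 : 0 < r m `^ (p - 1) by exact: powR_gt0.
rewrite /gradient_norm -powRM ?(ltW fine_energy_gt0) ?divr_ge0 ?(ltW phin0) ?(ltW rp0) //.
apply: (@le_trans _ _ ((2 ^+ n.-1) `^ p^-1)).
  have le2 : fine energy * (r m `^ (p - 1) / phi (r m) ^+ n.-1) <= 2 ^+ n.-1.
    have := energy_le; rewrite energy_fin lee_fin => h.
    have := ler_wpM2r (ltW (divr_gt0 rp0 phin0)) h; move/le_trans; apply.
    rewrite le_eqVlt; apply/orP; left; apply/eqP.
    have -> : (r m)^-1 `^ p = (r m * r m `^ (p - 1))^-1.
      by rewrite mulr_powRB1 ?(ltW r0) // -powR_inv1 ?(ltW r0) // -powRrM mulN1r powRN.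
    rewrite exprMn.
    have := gt_eqF phin0; have := gt_eqF rp0; have := gt_eqF r0.
    move: (r m `^ (p - 1)) (phi (r m) ^+ n.-1) (2 ^+ n.-1) (r m) => P F k s s0 P0 F0.
    by field; rewrite s0 P0 F0.
  by rewrite ge0_ler_powR ?nnegrE ?invr_ge0 ?(ltW p0) ?mulr_ge0 ?(ltW fine_energy_gt0)
    ?invr_ge0 ?(ltW phin0) ?(ltW rp0) ?exprn_ge0.
(* The exponent 1/p is at most 1 and the base is at least 1. *)
rewrite -[leRHS]powRr1 ?exprn_ge0 //; apply: ler_powR; last by rewrite invf_le1.
by rewrite exprn_ege1 // ler1n.
Qed.

End test_function.

(** * Orlicz functions and the Delta_2-condition *)

Section half_line_functions.
Context {R : realType}.
Implicit Types H : R -> R.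

Lemma increasing_le H : strictly_increasing_on_half_line H ->
  forall s t, 0 <= s -> s <= t -> H s <= H t.
Proof.
move=> Hi s t s0; rewrite le_eqVlt => /orP[/eqP->//|st].
exact/ltW/Hi.
Qed.

Lemma increasing_gt0 H : nonneg_on_half_line H ->
  strictly_increasing_on_half_line H -> forall t, 0 < t -> 0 < H t.
Proof. by move=> H0 Hi t t0; apply: le_lt_trans (Hi 0 t _ t0); rewrite ?H0. Qed.

Lemma Delta2_iter H : (forall t, 0 < t -> 0 < H t) -> Delta2 H ->
  exists2 C : R, 0 < C & forall k t, 0 < t -> H (2 ^+ k * t) <= C ^+ k * H t.
Proof.
move=> H0 [C HC]; have C0 : 0 < C.
  have := HC 1 ltr01; have := H0 1 ltr01; have := H0 (2 * 1).
  by rewrite mulr1 => /(_ (ltr0n _ 2)) h2 h1 h; rewrite -(pmulr_lgt0 _ h1) (lt_le_trans h2).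
exists C => // k t t0; elim: k => [|k IH]; first by rewrite !expr0 !mul1r.
rewrite !exprS -!mulrA; apply: le_trans (HC _ _) _; first by rewrite mulr_gt0 ?exprn_gt0.
by rewrite ler_pM2l.
Qed.

Lemma measurable_comp_normr H d (T : measurableType d) (f : T -> R) :
  continuous_on_half_line H -> measurable_fun setT f ->
  measurable_fun setT (fun x => H `|f x|).
Proof.
move=> cH mf; have m0 : measurable (`[0, +oo[%classic : set R) by exact: measurable_itv.
have mH : measurable_fun (`[0, +oo[%classic : set R) H.
  exact: subspace_continuous_measurable_fun.
have mf' : measurable_fun setT (fun x => `|f x|) by exact: measurableT_comp.
by apply: (measurable_comp m0 _ mH mf') => _ [x _ <-]; rewrite /= in_itv /= andbT.
Qed.

End half_line_functions.

(** * Oscillation of the test function on the cap *)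

Section cap_function_oscillation.
Context {R : realType} {n : nat} (hn : (2 <= n)%N) (phi : R -> R).
Hypothesis phi_gt0 : forall t, 0 < t -> 0 < phi t.
Variables (r : nat -> R) (a b : nat -> 'rV[R]_n).
Hypothesis rab : mushrooms hn phi r a b.
Variables (m : nat) (c : R).
Hypothesis c0 : 0 < c.

Let G := mushrooms_interior hn phi r a b.
Let M := mushroom hn phi r a b m.
Let mu : {sigma_finite_measure set 'rV[R]_n -> \bar R} := lebesgue_rV n.
Let u := cap_function hn phi r a b m c.
Let mG : measurable G. Proof. by apply: open_measurable_rV; exact: open_interior. Qed.
Let mM : measurable M. Proof. exact: mushroom_measurable. Qed.
Let mu_u : measurable_fun setT u. Proof. exact: cap_function_measurable. Qed.

(** The function is at most c/2 on the mushroom, and the mushroom has volume at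
most 2 (2r)^n.  Both sides are 0 for a domain of infinite volume, by the
conventions [fine +oo = 0] and [0^-1 = 0]. *)
Lemma average_cap_function_le :
  `|average G u| <= (fine (mu G))^-1 * (c * (2 * r m) ^+ n).
Proof.
have u0 x : 0 <= u x by case/andP: (cap_function_bound hn phi r a b m x (ltW c0)).
have A0 : 0 <= (fine (mu G))^-1 by rewrite invr_ge0 fine_ge0.
rewrite /average normrM (ger0_norm A0) ler_wpM2l //.
have I0 : (0 <= \int[mu]_(x in G) (u x)%:E)%E by apply: integral_ge0 => x _; rewrite lee_fin.
have I1 : (\int[mu]_(x in G) (u x)%:E <= (c * (2 * r m) ^+ n)%:E)%E.
  apply: (@le_trans _ _ (\int[mu]_(x in M) (c / 2)%:E)%E).
    rewrite [leLHS]integral_mkcond [leRHS]integral_mkcond; apply: ge0_le_integral => //.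
    - by move=> x _; rewrite patchE; case: ifP => // _; rewrite lee_fin.
    - apply: (measurable_restrictT _ mG).1; apply: measurable_funTS.
      exact/measurable_EFinP.
    - apply: (measurable_restrictT _ mM).1; exact: measurable_cst.
    move=> x _; rewrite !patchE; case: ifPn => _; case: ifPn => xM //; rewrite lee_fin.
    - by case/andP: (cap_function_bound hn phi r a b m x (ltW c0)).
    - by rewrite /u /cap_function patchE (negbTE xM).
    - by rewrite divr_ge0 // ltW.
  rewrite integral_cst //.
  apply: le_trans (_ : ((c / 2)%:E * (2 * (2 * r m) ^+ n)%:E <= _)%E).
    by apply: lee_wpmul2l; [rewrite lee_fin divr_ge0 // ltW|exact: lebesgue_mushroom_le].
  by rewrite -EFinM lee_fin mulrA divfK.
rewrite /Rintegral ger0_norm ?fine_ge0 //.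
by rewrite -lee_fin fineK // ge0_fin_numE // (le_lt_trans I1) // ltry.
Qed.

(** If the average is at most half of the value c/2 of the function on the cap,
the difference is at least c/4 on the cap.  The integral is restricted to the
concentric half of the cap, which has volume r^n and lies in the open domain. *)
Lemma cap_function_Orlicz_integral_ge (H : R -> R) : Orlicz H ->
  `|average G u| <= c / 4 ->
  ((r m ^+ n * H (c / 4))%:E <= \int[mu]_(x in G) (H `|u x - average G u|)%:E)%E.
Proof.
move=> OH avg; set v := average G u.
have H0 t : 0 <= t -> 0 <= H t := Orlicz_ge0 OH (t := t).
have mH : measurable_fun setT (fun x => H `|u x - v|).
  apply: measurable_comp_normr; first exact: Orlicz_continuous OH.
  by apply: measurable_funB => //; exact: measurable_cst.
have subG := half_cap_sub_domain rab (m := m).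
set Q := half_box _ _ in subG.
have mQ : measurable Q by exact: box_measurable.
apply: (@le_trans _ _ (\int[mu]_(x in Q) (H `|u x - v|)%:E)%E); last first.
  apply: ge0_subset_integral => //.
  - by apply: measurable_funTS; exact/measurable_EFinP.
  - by move=> x _; rewrite lee_fin H0.
apply: (@le_trans _ _ (\int[mu]_(x in Q) (H (c / 4))%:E)%E).
  rewrite integral_cst // [X in (_ * X)%E]lebesgue_half_box; last exact: (cap_sides_gt0 rab).
  rewrite -EFinM lee_fin mulrC le_eqVlt; apply/orP; left; apply/eqP; congr (_ * _).
  under eq_bigr do rewrite mxE mulrC mulKf //.
  by rewrite prodr_const card_ord.
apply: ge0_le_integral => //.
- by move=> x _; rewrite lee_fin H0 // divr_ge0 // ltW.
- by apply: measurable_funTS; exact/measurable_EFinP.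
move=> x Qx; rewrite lee_fin; apply: (increasing_le (Orlicz_increasing OH)).
  by rewrite divr_ge0 // ltW.
have -> : u x = c / 2.
  apply: (cap_function_cap rab); apply: half_box_sub_box Qx; exact: (cap_sides_gt0 rab).
have := ler_norm (c / 2 - v); have := ler_norm v; rewrite -/v in avg; lra.
Qed.

End cap_function_oscillation.

Lemma near_at_right_along {R : realType} (r : nat -> R) (P : R -> Prop) :
  (forall m, 0 < r m) -> r @ \oo --> 0 ->
  (\forall t \near 0^'+, P t) -> \forall m \near \oo, P (r m).
Proof.
move=> r0 r_cvg nP; have near_r : \forall m \near \oo, 0 < r m -> P (r m) := r_cvg _ nP.
by apply: filterS near_r => m /= h; exact: h (r0 m).
Qed.

Theorem theorem7p2 (R : realType) (n : nat) (hn : (2 <= n)%N)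
    (p : R) (hp : 1 <= p) (phi : R -> R)
    (phi_ge0 : nonneg_on_half_line phi)
    (phi_continuous : continuous_on_half_line phi)
    (phi_increasing : strictly_increasing_on_half_line phi)
    (phi_Delta2 : Delta2 phi)
    (phi_quasi : exists C : R, forall t1 t2 : R, 0 < t1 -> t1 <= t2 ->
      phi t1 / t1 <= C * (phi t2 / t2))
    (phi_le : exists2 t0 : R, 0 < t0 & forall t : R, 0 < t -> t < t0 -> phi t <= t)
    (G : set 'rV[R]_n) (hG : mushrooms_domain hn phi G)
    (H : R -> R) (H_Orlicz : Orlicz H) (H_Delta2 : Delta2 H)
    (H_cvg : t ^+ n * H ((t `^ (p - 1) / phi t ^+ n.-1) `^ p^-1)
      @[t --> 0^'+] --> +oo) :
  exists u : nat -> 'rV[R]_n -> R,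
    (forall k,
      [/\ L1p G p (u k),
          (exists2 g, weak_gradient G (u k) g & Lp_norm G p g = 1%E) &
          (lebesgue_rV n).-integrable G (EFin \o u k)]) /\
    (\int[lebesgue_rV n]_(x in G) (H `|u k x - average G (u k)|)%:E)%E
      @[k --> \oo] --> +oo%E.
Proof.
have phi_gt0 : forall t, 0 < t -> 0 < phi t := increasing_gt0 phi_ge0 phi_increasing.
have [r [a [b [rab GE]]]] := hG.
have {GE}-> : G = mushrooms_interior hn phi r a b by rewrite GE.
set D := mushrooms_interior hn phi r a b.
have rm0 m : 0 < r m := mushrooms_gt0 rab m.
pose T t := (t `^ (p - 1) / phi t ^+ n.-1) `^ p^-1.
pose N m := gradient_norm hn phi r a b p m.
have N0 m : 0 < N m by exact: gradient_norm_gt0.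
pose c m := (N m)^-1.
have c0 m : 0 < c m by rewrite invr_gt0.
exists (fun k => cap_function hn phi r a b k (c k)); split=> [k|].
  split.
  - exact: cap_function_L1p.
  - exists (cap_gradient hn phi r a b k (c k)); first exact: cap_function_weak_gradient.
    by rewrite Lp_norm_cap_gradient // ?(ltW (c0 k)) // mulVf // gt_eqF.
  - exact: cap_function_integrable.
have Hgt0 := increasing_gt0 (Orlicz_ge0 H_Orlicz) (Orlicz_increasing H_Orlicz).
have [C C0 HC] := Delta2_iter Hgt0 H_Delta2.
(* 2^(n-1) from the width of the stem, and 2^2 from the division by 4. *)
have Tc m : T (r m) <= 2 ^+ n.+1 * (c m / 4).
  have := gradient_norm_le phi_gt0 rab m hp; rewrite -/(N m) -/(T (r m)) => h.
  rewrite -(ler_pM2l (N0 m)); apply: le_trans h _.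
  have n2 : n.+1 = (n.-1 + 2)%N by rewrite addn2 prednK // ltnW.
  rewrite n2 exprD /c; have := N0 m; move: (2 ^+ n.-1) (N m) => s y y0.
  rewrite le_eqVlt; apply/orP; left; apply/eqP.
  by field; rewrite gt_eqF.
pose A := (fine (lebesgue_rV n D))^-1.
have A0 : 0 <= A by rewrite invr_ge0 fine_ge0.
(* The average is at most A c (2r)^n with A = 1/|G|, and 2r -> 0. *)
have avg : \forall m \near \oo, `|average D (cap_function hn phi r a b m (c m))| <= c m / 4.
  have e0 : 0 < (8 * (A + 1))^-1 by rewrite invr_gt0; lra.
  have near_e : \forall m \near \oo, `|r m| < (8 * (A + 1))^-1.
    by have /cvgr0Pnorm_lt := mushrooms_cvg rab; exact.
  apply: filterS near_e => m; rewrite ger0_norm ?(ltW (rm0 m)) // => rm.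
  apply: le_trans (average_cap_function_le phi_gt0 rab m (c0 m)) _.
  rewrite -/D -/A mulrCA ler_pM2l //.
  have r1 : 2 * r m * (4 * (A + 1)) <= 1.
    have A1 : 0 < 8 * (A + 1) by lra.
    have := ltW rm; rewrite -[(8 * _)^-1]mul1r ler_pdivlMr //; lra.
  have r2 : 2 * r m <= 1 by have := rm0 m; nra.
  apply: (@le_trans _ _ (A * (2 * r m))).
    rewrite ler_wpM2l // -[leRHS]expr1; apply: ler_wiXn2l => //; last exact: ltnW.
    by have := rm0 m; lra.
  by have := rm0 m; nra.
apply/cvgeyPge => L.
have big : \forall m \near \oo, L * C ^+ n.+1 <= r m ^+ n * H (T (r m)).
  apply: (near_at_right_along (P := fun t => L * C ^+ n.+1 <= t ^+ n * H (T t)) rm0 (mushrooms_cvg rab)).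
  exact: (cvgryPge _).1 H_cvg _.
near=> m.
have avgm : `|average D (cap_function hn phi r a b m (c m))| <= c m / 4 by near: m.
apply: le_trans (cap_function_Orlicz_integral_ge rab (c0 m) H_Orlicz avgm).
rewrite lee_fin -(ler_pM2r (exprn_gt0 n.+1 C0)).
apply: (@le_trans _ _ (r m ^+ n * H (T (r m)))); first by near: m.
rewrite -mulrA; apply: ler_wpM2l; first by rewrite exprn_ge0 // ltW.
rewrite [leRHS]mulrC; apply: le_trans (HC n.+1 _ _); last by rewrite divr_gt0.
apply: (increasing_le (Orlicz_increasing H_Orlicz)); first exact: powR_ge0.
exact: Tc.
Unshelve. all: by end_near. Qed.
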